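(* Let $\tau$ be a finite relational signature. A class $\mathcal{C}\subseteq\mathsf{FIN}(\tau)$ is decided by an adaptive right unbounded query algorithm over $\mathbb{B}$ if and only if $\mathcal{C}$ is clopen in the topological space $(\mathsf{FIN}(\tau),\mathfrak{T}')$.
   Context: $\mathsf{FIN}(\tau)$ is the class of finite relational structures of signature $\tau$ with non-empty domain (classes closed under isomorphism). For $A\in\mathsf{FIN}(\tau)$, $\downarrow A=\{B\in\mathsf{FIN}(\tau): \text{there is a homomorphism } B\to A\}$. $\mathfrak{T}'$ is the topology on $\mathsf{FIN}(\tau)$ generated by the subbasis $\{\downarrow A: A\in\mathsf{FIN}(\tau)\}\cup\{\mathsf{FIN}(\tau)\setminus\downarrow A: A\in\mathsf{FIN}(\tau)\}$. $\hom_{\mathbb{B}}(A,F)$ is $1$ if there is a homomorphism $A\to F$ and $0$ otherwise. For a set $\Sigma$, $\Sigma^{<\omega}$ is the set of finite strings over $\Sigma$; a subtree is a prefix-closed subset, a leaf an element with no proper extension. An adaptive right unbounded query algorithm over $\mathbb{B}$ is a function $G:\mathcal{T}\to\mathsf{FIN}(\tau)\cup\{\mathsf{YES},\mathsf{NO}\}$ with $\mathcal{T}\subseteq\{0,1\}^{<\omega}$ a subtree and $G(\sigma)\in\{\mathsf{YES},\mathsf{NO}\}$ iff $\sigma$ is a leaf; its computation path on $A$ is the limit of $\sigma_0=\varepsilon$, $\sigma_{i+1}=\sigma_i$ if $G(\sigma_i)\in\{\mathsf{YES},\mathsf{NO}\}$, else $\sigma_{i+1}=\sigma_i\bullet\hom_{\mathbb{B}}(A,G(\sigma_i))$;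 it must be total (finite path on every input) and decides $\{A:G(\text{path of }A)=\mathsf{YES}\}$. *)

(* Defs.v *)
From HB Require Import structures.
From mathcomp Require Import all_boot all_classical topology.

Set Implicit Arguments.
Unset Strict Implicit.
Unset Printing Implicit Defensive.

Local Open Scope classical_set_scope.

Record signature := Signature {
  symbol :> finType;
  arity : symbol -> nat }.
Arguments arity {s} _.

(* The points of [fin_str tau] are structures, not isomorphism types; see
   [iso_closed] for classes. Universe pitfall: the library's ordinals are
   declared in a universe too large for [dom]; {k : nat | k < n} is accepted,
   so every isomorphism type of finite structures is represented. *)
Record fin_str (tau : signature) := FinStr {
  dom :> Type;
  dom_finite : finite_set [set: dom];
  dom_nonempty : [set: dom] !=set0;
  interp : forall R : tau, set ((arity R).-tuple dom) }.
Arguments interp {tau} _ _ _.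

HB.instance Definition _ (tau : signature) := gen_eqMixin (fin_str tau).
HB.instance Definition _ (tau : signature) := gen_choiceMixin (fin_str tau).

Section Structures.
Variable tau : signature.
Implicit Types A B : fin_str tau.

Definition is_hom A B (h : A -> B) : Prop :=
  forall (R : tau) (t : (arity R).-tuple A),
    interp A R t -> interp B R (map_tuple h t).

Definition hom_exists A B : Prop := exists h : A -> B, is_hom h.

Definition homB A B : bool := `[< hom_exists A B >].

Definition isomorphic A B : Prop :=
  exists2 h : A -> B, bijective h &
    forall (R : tau) (t : (arity R).-tuple A),
      interp A R t <-> interp B R (map_tuple h t).

Definition iso_closed (C : set (fin_str tau)) : Prop :=
  forall A B, isomorphic A B -> C A -> C B.

Definition hom_down A : set (fin_str tau) := [set B | hom_exists B A].

Definition hom_subbase : set (set (fin_str tau)) :=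
  range hom_down `|` range (fun A => ~` hom_down A).

End Structures.

HB.instance Definition _ (tau : signature) :=
  @isSubBaseTopological.Build (fin_str tau)
    (set (fin_str tau)) (@hom_subbase tau) id.

Variant response (tau : signature) :=
  | Query of fin_str tau
  | YES
  | NO.
Arguments YES {tau}.
Arguments NO {tau}.

Definition is_answer (tau : signature) (r : response tau) : Prop :=
  r = YES \/ r = NO.

Definition prefix_closed (T : set (seq bool)) : Prop :=
  forall s t, prefix s t -> T t -> T s.

Definition leaf (T : set (seq bool)) (s : seq bool) : Prop :=
  T s /\ forall t, T t -> prefix s t -> t = s.

(* The function has domain [tree]; values of [answer] outside [tree] are junk
   and are never used, since [computation_path] requires its end, hence every
   string along it, to be in [tree]. *)
Record query_algorithm (tau : signature) := QueryAlgorithm {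
  tree : set (seq bool);
  answer :> seq bool -> response tau;
  tree_prefix_closed : prefix_closed tree;
  answer_leafP : forall s, tree s -> (is_answer (answer s) <-> leaf tree s) }.

Section Computation.
Variables (tau : signature) (G : query_algorithm tau).
Implicit Types A : fin_str tau.

Definition step A (s : seq bool) : seq bool :=
  if G s is Query F then rcons s (homB A F) else s.

Definition stage A (i : nat) : seq bool := iter i (step A) [::].

(* A finite limit of a sequence of strings, each a prefix of the next, is its
   eventual value. *)
Definition computation_path A (s : seq bool) : Prop :=
  tree G s /\ \forall i \near \oo, stage A i = s.

Definition is_total : Prop := forall A, exists s, computation_path A s.

Definition decided_class : set (fin_str tau) :=
  [set A | exists2 s, computation_path A s & G s = YES].

End Computation.

Definition decided_by_query_algorithm (tau : signature)
    (C : set (fin_str tau)) : Prop :=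
  exists G : query_algorithm tau, is_total G /\ decided_class G = C.

(* Main.v *)
(* Up to homomorphic equivalence there are only countably many finite
   structures, say E 0, E 1, ..., and every subbasic open set is determined by
   the answer to one query hom(-, E i). Hence, for a clopen class, each input has
   a finite sequence of answers that already forces membership or
   non-membership: query E 0, E 1, ... until this happens. Conversely, a finite
   computation depends on finitely many answers, so it is shared by a whole
   neighbourhood of the input. *)
Require Import Defs.
From mathcomp Require Import finmap all_boot all_classical topology.

Set Implicit Arguments.
Unset Strict Implicit.
Unset Printing Implicit Defensive.

Local Open Scope classical_set_scope.

Lemma hom_exists_trans (tau : signature) (A B D : fin_str tau) :
  hom_exists A B -> hom_exists B D -> hom_exists A D.
Proof.
move=> [f fhom] [g ghom]; exists (g \o f) => R t /fhom /ghom.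
by congr (interp D R _); apply: val_inj; rewrite /= -map_comp.
Qed.

(** * Countably many structures up to homomorphic equivalence *)

Section Enumeration.
Variable tau : signature.

(** A structure is coded by the finite set of its facts, each a symbol with a tuple; [n.+1] keeps
    the domain non-empty. *)
Definition str_code : countType :=
  {n : nat & {set {R : tau & (arity R).-tuple 'I_n.+1}}}.

Definition initial_segment (n : nat) : Type := {k : nat | k < n.+1}.

Lemma initial_segment_finite n : finite_set [set: initial_segment n].
Proof.
rewrite (_ : [set: _] = (@proj1_sig _ _) @^-1` `I_n.+1).
  by apply: finite_preimage (finite_II _) => x y _ _ /val_inj.
by apply/seteqP; split => // -[].
Qed.

Lemma initial_segment_nonempty n : [set: initial_segment n] !=set0.
Proof. by exists (exist _ 0 (ltn0Sn n)). Qed.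

Definition ord_of_initial n (x : initial_segment n) : 'I_n.+1 :=
  Ordinal (valP x).

Definition decode (c : str_code) : fin_str tau :=
  @FinStr tau (initial_segment (tag c)) (initial_segment_finite (tag c))
    (initial_segment_nonempty (tag c))
    (fun R t => existT (fun R : tau => (arity R).-tuple 'I_(tag c).+1) R
                  (map_tuple (@ord_of_initial (tag c)) t) \in tagged c).

(** The facts of [F] are copied along an injection into an initial segment of the naturals. Points
    off the image lie in no fact, so a map back may send them anywhere; these spare points cost
    isomorphism but not homomorphic equivalence. *)
Lemma decode_hom_equivalent (F : fin_str tau) :
  exists c, hom_exists F (decode c) /\ hom_exists (decode c) F.
Proof.
have /finite_set_leP[n /pcard_leP[f]] := @dom_finite tau F.
have f_lt x : f x < n.+1 by apply/ltnW; exact: (@funS _ _ _ _ f).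
have [x0 _] := @dom_nonempty tau F.
have f_inj : injective f by move=> x y; apply: (@inj _ _ setT); rewrite inE.
(* [g] is a left inverse of [f]; off the image its value is unconstrained, and [x0] only shows that
   some value exists. *)
have /choice[g gK] k : exists y, forall x, f x = k -> y = x.
  have [[x fx]|nf] := pselect (exists x, f x = k).
    by exists x => y; rewrite -fx => /f_inj.
  by exists x0 => x fx; case: nf; exists x.
pose S := finset (fun p : {R : tau & (arity R).-tuple 'I_n.+1} =>
  `[< exists2 t : (arity (tag p)).-tuple F,
        interp F (tag p) t & map f t = map val (tagged p) >]).
exists (existT _ n S : str_code).
split.
  exists (fun x => exist _ (f x) (f_lt x)) => R t Ft.
  rewrite /= inE; apply/asboolP; exists t => //=.
  by rewrite -!map_comp.
exists (fun y => g (proj1_sig y)) => R t /=.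
rewrite inE => /asboolP[/= u Fu fu].
congr (interp F R _): Fu; apply: val_inj => /=.
rewrite [in RHS](map_comp g) (_ : map _ t = map f u).
  by rewrite -map_comp (@eq_map _ _ _ id) ?map_id // => x /=; apply: gK.
by rewrite fu -map_comp.
Qed.

(** Numbers that code nothing yield the one-point structure without facts. *)
Definition enum_str (n : nat) : fin_str tau :=
  decode (odflt (existT _ 0 finset.set0 : str_code) (unpickle n)).

Lemma enum_str_hom_equivalent (F : fin_str tau) : exists n,
  hom_exists F (enum_str n) /\ hom_exists (enum_str n) F.
Proof.
by have [c cP] := decode_hom_equivalent F; exists (pickle c); rewrite /enum_str pickleK.
Qed.

End Enumeration.

(** * Finite sequences of answers and neighbourhoods *)

Section Profile.
Variable tau : signature.
Implicit Types A B F : fin_str tau.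

Definition profile A (n : nat) : seq bool :=
  mkseq (fun i => homB A (enum_str tau i)) n.

(** Homomorphically equivalent targets receive equal answers, so the answer for [F] is an entry of
    the profile once [n] exceeds the index of an equivalent structure. *)
Lemma profile_separates F : \forall n \near \oo,
  forall A B, profile A n = profile B n -> homB A F = homB B F.
Proof.
have [i [Fi iF]] := enum_str_hom_equivalent F.
have homBi A : homB A F = homB A (enum_str tau i).
  by apply/asboolP/asboolP => AF; exact: hom_exists_trans AF _.
exists i.+1 => // n /= lt_in A B /(congr1 (nth false ^~ i)).
by rewrite !nth_mkseq // !homBi.
Qed.

Lemma hom_downE F A : hom_down F A = homB A F.
Proof. exact/esym/asboolE. Qed.

Lemma nbhs_subbase A (V : set (fin_str tau)) : nbhs A V ->
  exists S : {fset set (fin_str tau)},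
    (forall W, W \in S -> hom_subbase W /\ W A) /\
    \bigcap_(W in [set` S]) W `<=` V.
Proof.
rewrite nbhsE => -[O [[Os Os_base <-] [P OsP PA]] OV].
have [S Ssub PE] := Os_base _ OsP.
rewrite -PE in PA; exists S; split=> [W WS|B SB].
  by split; [apply: set_mem; exact: Ssub|exact: PA].
by apply: OV; exists P => //; rewrite -PE.
Qed.

(** A basic neighbourhood is cut out by finitely many subbasic sets, each read off one query;
    finitely many eventual conditions hold together from some [n] on. *)
Lemma nbhs_profile A (V : set (fin_str tau)) :
  nbhs A V -> \forall n \near \oo, forall B, profile B n = profile A n -> V B.
Proof.
move=> /nbhs_subbase[S [S_A SV]].
pose ensures (W : set (fin_str tau)) : set nat :=
  [set n | forall B, profile B n = profile A n -> W B].
have ensuresS W : W \in S -> \forall n \near \oo, ensures W n.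
  move=> /S_A[[[F _ WE]|[F _ WE]] WA].
    apply: filterS (profile_separates F) => n sep B /sep AB.
    by move: WA; rewrite -WE !hom_downE AB.
  apply: filterS (profile_separates F) => n sep B /sep AB.
  by move: WA; rewrite -WE /setC /= !hom_downE AB.
apply: filterS (filter_bigI _ ensuresS) => n SW B BA.
by apply: SV => W WS; exact: SW WS _ BA.
Qed.

(** Here the complements in the subbase matter: whichever answer [A] gives, the structures sharing
    it form an open set. *)
Lemma near_homB A F : \forall B \near A, homB B F = homB A F.
Proof.
have subbase_open W : hom_subbase W -> open W.
  move=> WS; exists [set W]; last by rewrite bigcup_set1.
  by move=> _ ->; exact: (@finI_from1 _ _ _ id).
have [AF|nAF] := pselect (hom_down F A).
  have : nbhs A (hom_down F).
    by apply: open_nbhs_nbhs; split=> //; apply: subbase_open; left; exists F.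
  by apply: filterS => B BF; rewrite /homB !asboolT.
have : nbhs A (~` hom_down F).
  by apply: open_nbhs_nbhs; split=> //; apply: subbase_open; right; exists F.
by apply: filterS => B nBF; rewrite /homB !asboolF.
Qed.

End Profile.

(** * From algorithms to clopen classes *)

Section Decided.
Variables (tau : signature) (G : query_algorithm tau).
Implicit Types A B : fin_str tau.

Lemma stageS A i : stage G A i.+1 = step G A (stage G A i).
Proof. by []. Qed.

(** The next query depends only on the string so far, so inputs that agree up to [i] meet the same
    query, and nearby inputs answer it alike. *)
Lemma near_stage A i : \forall B \near A, stage G B i = stage G A i.
Proof.
elim: i => [|i IH]; first exact: (@nearW _ (nbhs A)).
have : \forall B \near A, step G B (stage G A i) = step G A (stage G A i).
  rewrite /step; case: (G _) => [F| |]; [|exact: (@nearW _ (nbhs A))..].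
  by apply: filterS (near_homB A F) => B ->.
by apply: filterS2 IH => B BA AE; rewrite stageS BA AE.
Qed.

Lemma computation_path_uniq A s t :
  computation_path G A s -> computation_path G A t -> s = t.
Proof.
by move=> [_ As] [_ At]; have [i [<- <-]] := filter_ex (filterI As At).
Qed.

Lemma step_answer A s : is_answer (G s) -> step G A s = s.
Proof. by rewrite /step; case=> ->. Qed.

Lemma stage_answer A n : is_answer (G (stage G A n)) ->
  \forall i \near \oo, stage G A i = stage G A n.
Proof.
move=> ans; exists n => // i /= /subnKC <-; elim: (i - n) => [|k IH].
  by rewrite addn0.
by rewrite addnS stageS IH step_answer.
Qed.

Lemma computation_path_answer A s : computation_path G A s -> is_answer (G s).
Proof.
(* A query at a stable stage would lengthen the string at the next one. *)
move=> [_ [n _ As]]; have := As n.+1 (leqnSn n).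
rewrite stageS As //= /step.
case: (G s) => [F /(congr1 size)| _ | _]; [|by left|by right].
by rewrite size_rcons => /eqP; rewrite eqn_leq ltnn.
Qed.

Lemma near_computation_path A s :
  computation_path G A s -> \forall B \near A, computation_path G B s.
Proof.
move=> As; have ans := computation_path_answer As.
have [Ts /filter_ex[i si]] := As.
apply: filterS (near_stage A i) => B; rewrite si => sB.
by split=> //; rewrite -sB; apply: stage_answer; rewrite sB.
Qed.

Lemma decided_class_clopen : Defs.is_total G -> clopen (decided_class G).
Proof.
move=> Gtot; split; [|rewrite -openC]; rewrite openE => A.
  move=> [s As Gs]; apply: filterS (near_computation_path As) => B Bs.
  by exists s.
(* By totality an input outside the class has a path too; nearby inputs share it, and uniqueness
   rules out an accepting one. *)
have [s As] := Gtot A; move=> nA; apply: filterS (near_computation_path As).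
move=> B Bs [t Bt Gt]; apply: nA; exists s => //.
by rewrite (computation_path_uniq Bs Bt).
Qed.

End Decided.

(** * From clopen classes to algorithms *)

Section Exhaustive.
Variables (tau : signature) (C : set (fin_str tau)).
Implicit Types (A B : fin_str tau) (s t : seq bool).

Definition consistent s : set (fin_str tau) :=
  [set B | profile B (size s) = s].

(** If no structure is consistent with [s], both tests succeed and the verdict is arbitrary; no
    input reaches such a string. *)
Definition exhaustive_answer s : response tau :=
  if `[< consistent s `<=` C >] then YES else
  if `[< consistent s `<=` ~` C >] then NO else Query (enum_str tau (size s)).

(** Cutting each branch at its first answer makes the answering strings exactly the leaves. *)
Definition exhaustive_tree : set (seq bool) :=
  [set s | forall t, prefix t s -> is_answer (exhaustive_answer t) -> t = s].

Lemma exhaustive_tree_prefix_closed : prefix_closed exhaustive_tree.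
Proof.
move=> s t st Tt u us ans; have ut := Tt u (prefix_trans us st) ans.
move: us; rewrite ut => ts; apply/eqP.
by rewrite -[s](@take_oversize _ (size t)) ?size_prefix // eq_sym -prefixE.
Qed.

Lemma exhaustive_tree_rcons s b : exhaustive_tree s ->
  ~ is_answer (exhaustive_answer s) -> exhaustive_tree (rcons s b).
Proof.
move=> Ts noans t; rewrite prefixE => /eqP ts ans.
have [|ge] := ltnP (size t) (size (rcons s b)); last by rewrite -ts take_oversize.
rewrite size_rcons ltnS => le_ts.
move: ts; rewrite -cats1 takel_cat // => ts.
by case: noans; rewrite -(Ts t) // prefixE ts.
Qed.

Lemma exhaustive_answer_leafP s : exhaustive_tree s ->
  (is_answer (exhaustive_answer s) <-> leaf exhaustive_tree s).
Proof.
move=> Ts; split=> [ans|[_ s_leaf]].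
  by split=> // t Tt st; apply/esym/Tt.
apply: contrapT => /(@exhaustive_tree_rcons s true Ts)/s_leaf.
move=> /(_ (prefix_rcons s true))/(congr1 size)/eqP.
by rewrite size_rcons eqn_leq ltnn.
Qed.

Definition exhaustive_algorithm : query_algorithm tau :=
  QueryAlgorithm exhaustive_tree_prefix_closed exhaustive_answer_leafP.

Local Notation G := exhaustive_algorithm.

(** Until an answer appears, the length counts the queries asked, so the next query is the next
    enumerated structure and the string remains a profile of [A]. *)
Lemma exhaustive_stage A i : [/\ exhaustive_tree (stage G A i),
  consistent (stage G A i) A &
  size (stage G A i) = i \/ is_answer (G (stage G A i))].
Proof.
elim: i => [|i [Ts sA s_long]].
  by split=> //; [move=> t; rewrite prefixs0 => /eqP|left].
rewrite stageS; set s := stage G A i in Ts sA s_long *.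
have [ans|noans] := pselect (is_answer (G s)).
  by rewrite step_answer //; split=> //; right.
case: s_long => // si; rewrite /step.
case E: (G s) => [F||]; [|by case: noans; left|by case: noans; right].
have -> : F = enum_str tau (size s).
  by move: E; rewrite /= /exhaustive_answer; do 2 case: ifP => _ //; case.
split; [exact: exhaustive_tree_rcons| |by left; rewrite size_rcons si].
by rewrite /consistent /= size_rcons /profile mkseqS -/(profile _ _) sA.
Qed.

Lemma exhaustive_path A : clopen C -> exists s, computation_path G A s.
Proof.
move=> [Copen Cclosed].
(* [C] and its complement are both open, so some finite profile of [A] forces membership or
   non-membership. *)
have /filter_ex[n nA] : \forall n \near \oo, forall B,
    profile B n = profile A n -> C B <-> C A.
  apply: nbhs_profile; have [CA|nCA] := pselect (C A).
    by apply: filterS (open_nbhs_nbhs (conj Copen CA)) => B CB.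
  by apply: filterS (open_nbhs_nbhs (conj (closed_openC Cclosed) nCA)) => B nCB.
have [Ts sA s_long] := exhaustive_stage A n.
exists (stage G A n); split=> //; apply: stage_answer.
case: s_long => // sn; set s := stage G A n in sA sn *.
have sC B : consistent s B -> C B <-> C A.
  by move=> sB; apply: nA; rewrite -sn sB sA.
rewrite /= /exhaustive_answer; case: asboolP => [_|nC]; first by left.
case: asboolP => [_|nnC]; first by right.
have [CA|nCA] := pselect (C A).
  by case: nC => B /sC ->.
by case: nnC => B /sC BA /BA.
Qed.

(** [A] is consistent with every stage of its own run, so a verdict valid for all consistent
    structures applies to it. *)
Lemma exhaustive_path_sound A s : computation_path G A s ->
  (G s = YES -> C A) /\ (G s = NO -> ~ C A).
Proof.
move=> [_ /filter_ex[i <-]].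
have [_ sA _] := exhaustive_stage A i; rewrite /= /exhaustive_answer.
case: asboolP => [sC|_]; first by split=> // _; exact: sC.
by case: asboolP => [sC|_]; split=> // _; exact: sC.
Qed.

Lemma clopen_decided : clopen C -> decided_by_query_algorithm C.
Proof.
move=> Cclopen; exists G; split=> [A|]; first exact: exhaustive_path.
apply/seteqP; split=> A; first by move=> [s /exhaustive_path_sound[sC _]] /sC.
move=> CA; have [s As] := exhaustive_path A Cclopen; exists s => //.
have [|/(proj2 (exhaustive_path_sound As))] // := computation_path_answer As.
Qed.

End Exhaustive.

Theorem theorem30 (tau : signature) (C : set (fin_str tau))
    (C_iso : iso_closed C) :
  decided_by_query_algorithm C <-> clopen C.
Proof.
split; last exact: clopen_decided.
by case=> G [Gtot <-]; exact: decided_class_clopen.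
Qed.
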